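(* Fix integers $c\ge 2$ and $r\ge 3$, let $\bm a\in\{1,\dots,c-1\}^r$ be an admissible $r$-palette, and let $\theta_1,\dots,\theta_{c-1}>0$ be such that $\sum_{b\in S(\bm a)}w_b\theta_b=2$ and $\theta_{\max}<1$. Then $$\mathrm{TV}\left(X_{r,n}(\bm a),\mathrm{Pois}\left(\frac1{2(r-1)}\right)\right)\lesssim_r\max\{n^{-1+\theta_{\max}},\,n^{-\theta_{\min}}\},$$ where $\theta_{\min}=\min_{b\in S(\bm a)}\theta_b>0$, and the right-hand side tends to $0$ as $n\to\infty$. In particular, $X_{r,n}(\bm a)$ converges in distribution to $\mathrm{Pois}\left(\frac1{2(r-1)}\right)$.
   Context: Notation: $[n]=\{1,\dots,n\}$. An $r$-AP in $[n]$ is an ordered tuple $\bm x=(x,x+d,\dots,x+(r-1)d)$ with $d\ge 1$ an integer and all entries in $[n]$. An $r$-palette is an ordered sequence $\bm a=(a_1,\dots,a_r)\in[c]^r$; it is admissible if $\bm a\in[c-1]^r$. Given a coloring $\phi_n:[n]\to[c]$, an $r$-AP is $\bm a$-colorful if $\phi_n(x+(s-1)d)=a_s$ for every $s\in[r]$. Random coloring: with fixed $\theta_1,\dots,\theta_{c-1}>0$ and $n$ large, each element of $[n]$ is independently assigned color $b\in[c]$ with probability $p_b$, where $p_b=n^{-\theta_b}$ for $b\in[c-1]$ and $p_c=1-\sum_{b=1}^{c-1}p_b$. $X_{r,n}(\bm a)$ is the number of $\bm a$-colorful $r$-APs in $[n]$ under this random coloring. $S(\bm a)$ is the set of distinct colors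 appearing in $\bm a$, $w_b$ is the number of times color $b\in S(\bm a)$ appears in $\bm a$, and $\theta_{\max}=\max_{b\in S(\bm a)}\theta_b$. $\mathrm{TV}$ is the total variation distance between laws, $\sup_A|\mathbb P(X\in A)-\mathbb P(Y\in A)|$. The notation $u_n\lesssim_r v_n$ means there is a constant $C>0$ depending only on $r$ with $u_n\le Cv_n$ for all sufficiently large $n$. *)

(* Defs.v *)
From HB Require Import structures.
From mathcomp Require Import all_boot all_order all_algebra.
From mathcomp Require Import all_classical all_reals all_analysis.

Set Implicit Arguments.
Unset Strict Implicit.
Unset Printing Implicit Defensive.

Import Order.TTheory GRing.Theory Num.Theory.
Import numFieldNormedType.Exports.

Local Open Scope classical_set_scope.
Local Open Scope ring_scope.

(* Colors are the natural numbers 1, ..., c, while [i : 'I_n] stands for the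
   element [i + 1] of {1, ..., n}; being an arithmetic progression is invariant
   under this translation. *)

Definition is_AP (r n : nat) (t : r.-tuple 'I_n) : Prop :=
  exists x d : nat, (0 < d)%N /\
    forall s : 'I_r, tnth t s = (x + s * d)%N :> nat.

Definition admissible (c r : nat) (a : r.-tuple nat) : Prop :=
  forall s : 'I_r, (1 <= tnth a s <= c.-1)%N.

Definition colorful (r n : nat) (a : r.-tuple nat) (phi : 'I_n -> nat)
    (t : r.-tuple 'I_n) : bool :=
  [forall s : 'I_r, phi (tnth t s) == tnth a s].

Definition num_colorful (r n : nat) (a : r.-tuple nat) (phi : 'I_n -> nat)
    : nat :=
  #|[pred t : r.-tuple 'I_n | `[< is_AP t >] && colorful a phi t]|.

Definition colors (r : nat) (a : r.-tuple nat) : seq nat := undup a.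

Definition weight (r : nat) (a : r.-tuple nat) (b : nat) : nat :=
  count_mem b a.

(* The extrema over [colors a]; the default value is itself the value of
   [theta] at an element of [colors a] as soon as [0 < r]. *)
Definition theta_max (R : realType) (theta : nat -> R) (r : nat)
    (a : r.-tuple nat) : R :=
  \big[Num.max/theta (head 0%N a)]_(b <- colors a) theta b.

Definition theta_min (R : realType) (theta : nat -> R) (r : nat)
    (a : r.-tuple nat) : R :=
  \big[Num.min/theta (head 0%N a)]_(b <- colors a) theta b.

Definition mutually_independent (R : realType) (d d' : measure_display)
    (Omega : measurableType d) (T : measurableType d')
    (P : probability Omega R) (I : finType) (X : I -> {RV P >-> T}) : Prop :=
  forall (J : {set I}) (B : I -> set T),
    (forall i, measurable (B i)) ->
    P (\bigcap_(i in [set` J]) (X i @^-1` B i)) =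
      (\prod_(i in J) P (X i @^-1` B i))%E.

(* For small [n] the value at color [c] may be negative; no random coloring in
   the sense below then exists, so it is only assumed for [n] near infinity. *)
Definition color_prob (R : realType) (c : nat) (theta : nat -> R) (n b : nat)
    : R :=
  if (b < c)%N then n%:R `^ (- theta b)
  else 1 - \sum_(1 <= b' < c) n%:R `^ (- theta b').

Record random_coloring (R : realType) (c : nat) (theta : nat -> R) (n : nat)
    (d : measure_display) (Omega : measurableType d) (P : probability Omega R)
    (phi : 'I_n -> {RV P >-> nat}) : Prop := RandomColoring {
  coloring_range : forall i w, (1 <= phi i w <= c)%N ;
  coloring_prob : forall i b, (1 <= b <= c)%N ->
    P (phi i @^-1` [set b]) = (color_prob c theta n b)%:E ;
  coloring_indep : mutually_independent phi }.

Section colorful_count.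
Context (R : realType) (r n : nat) (a : r.-tuple nat) (d : measure_display)
  (Omega : measurableType d) (P : probability Omega R)
  (phi : 'I_n -> {RV P >-> nat}).

Definition colorful_count : Omega -> nat :=
  fun w => num_colorful a (fun i => phi i w).

Lemma measurable_colorful_count : measurable_fun [set: Omega] colorful_count.
Proof.
rewrite (_ : colorful_count = fun w =>
    (\sum_(t : r.-tuple 'I_n | `[< is_AP t >])
      nat_of_bool (colorful a (fun i => phi i w) t))%N); last first.
  apply/funext => w; rewrite /colorful_count /num_colorful -sum1_card.
  by rewrite big_mkcondr /=; apply: eq_bigr => t _; case: ifP.
elim: (index_enum _) => [|t s IH].
  by under eq_fun do rewrite big_nil; exact: measurable_cst.
under eq_fun do rewrite big_cons.
case: asboolP => // _; apply: measurable_realfun.measurable_fun_addn => //.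
apply: (@measurableT_comp _ _ _ _ _ _ nat_of_bool) => //.
apply: (@measurable_fun_bool _ _ _ _ true); rewrite setTI.
rewrite (_ : _ @^-1` _ =
    \bigcap_(i in [set: 'I_r]) (phi (tnth t i) @^-1` [set tnth a i])).
  apply: fin_bigcap_measurable => // i _.
  by rewrite -[X in measurable X]setTI; exact: measurable_funPT.
by apply/seteqP; split => w /=; [move=> /forallP h i _; exact/eqP
  | move=> h; apply/forallP => i; exact/eqP/h].
Qed.

HB.instance Definition _ := isMeasurableFun.Build _ _ _ _ colorful_count
  measurable_colorful_count.

End colorful_count.

Definition tv_distance (R : realType) (d : measure_display)
    (T : measurableType d) (mu nu : probability T R) : \bar R :=
  ereal_sup [set `|mu A - nu A|%E | A in measurable].

(* The last argument of [poisson_prob] is not used in its definition. *)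
Definition Pois (R : realType) (lambda : R) : probability nat R :=
  poisson_prob lambda 0.

Section natr_rv.
Context (R : realType).

Definition real_of_nat (k : nat) : R := k%:R.

Lemma measurable_real_of_nat : measurable_fun [set: nat] real_of_nat.
Proof. by []. Qed.

HB.instance Definition _ := isMeasurableFun.Build _ _ _ _ real_of_nat
  measurable_real_of_nat.
End natr_rv.

Definition cvg_in_distribution (R : realType)
    (d : nat -> measure_display) (Omega : forall n, measurableType (d n))
    (P : forall n, probability (Omega n) R) (X : forall n, {RV P n >-> R})
    (d' : measure_display) (Omega' : measurableType d')
    (Q : probability Omega' R) (Y : {RV Q >-> R}) : Prop :=
  forall x : R, {for x, continuous (cdf Y)} ->
    cdf (X n) x @[n --> \oo] --> cdf Y x.

Arguments cvg_in_distribution {R d Omega} P X {d' Omega'} Q Y.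

(* Main.v *)
(* Chen-Stein method. Let [f] solve the Stein equation
   [lambda f(k+1) - k f(k) = 1_A(k) - Pois(lambda)(A)]. Write the count as
   [X = sum_t I_t] and let [V_t] be the part of [X] coming from the
   progressions disjoint from [t]. As [I_t] and [V_t] are independent,
   [E(p_t f(X+1) - I_t f(X))] only involves the differences [f(X+1) - f(V_t+1)]
   and [f(X) - f(V_t+1)] on [I_t = 1], so that
   [|P(X in A) - Pois(lambda)(A)|] is at most a constant times
   [|lambda - E X| + sum p_t p_t' + sum E(I_t I_t')], over the pairs of
   intersecting progressions. Every [p_t] is [n^-2] and there are
   [n^2 / (2 (r - 1)) + O(n)] progressions, which makes the first term
   [O(1/n)]. The [O(n^3)] pairs with one common element contribute at most
   [n^(-4 + theta_max)] each. For the [O(n^2)] pairs with at least two common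
   elements, some element of [t'] is outside [t], and they contribute at most
   [n^(-2 - theta_min)] each. *)
Require Import Defs.
From mathcomp Require Import all_boot all_order all_algebra.
From mathcomp Require Import all_classical all_reals all_analysis.
From mathcomp Require Import ring lra zify.
Set Implicit Arguments.
Unset Strict Implicit.
Unset Printing Implicit Defensive.
Import Order.TTheory GRing.Theory Num.Theory.
Import numFieldNormedType.Exports.
Local Open Scope classical_set_scope.
Local Open Scope ring_scope.

(** * Expectation and the Chen-Stein bound on a finite space *)

Section Expectation.
Context {R : realFieldType} {O : finType} (W : O -> R).

Definition expect (F : O -> R) : R := \sum_g W g * F g.

Lemma eq_expect F G : F =1 G -> expect F = expect G.
Proof. by move=> FG; apply: eq_bigr => g _; rewrite FG. Qed.

Lemma expectB F G : expect (fun g => F g - G g) = expect F - expect G.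
Proof. by rewrite -sumrB; apply: eq_bigr => g _; rewrite mulrBr. Qed.

Lemma expectZ c F : expect (fun g => c * F g) = c * expect F.
Proof. by rewrite mulr_sumr; apply: eq_bigr => g _; rewrite mulrCA. Qed.

Lemma expect_sum (T : finType) (A : {set T}) (F : T -> O -> R) :
  expect (fun g => \sum_(t in A) F t g) = \sum_(t in A) expect (F t).
Proof. by rewrite exchange_big /=; apply: eq_bigr => g _; rewrite mulr_sumr. Qed.

Hypothesis W_ge0 : forall g, 0 <= W g.

Lemma expect_le F G : (forall g, F g <= G g) -> expect F <= expect G.
Proof. by move=> FG; apply: ler_sum => g _; rewrite ler_wpM2l. Qed.

Lemma norm_expect_le F G : (forall g, `|F g| <= G g) ->
  `|expect F| <= expect G.
Proof.
move=> FG; apply: le_trans (ler_norm_sum _ _ _) _; apply: ler_sum => g _.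
by rewrite normrM ger0_norm // ler_wpM2l.
Qed.

Hypothesis W_sum1 : \sum_g W g = 1.

Lemma expect_cst c : expect (fun=> c) = c.
Proof. by rewrite /expect -mulr_suml W_sum1 mul1r. Qed.

End Expectation.

Section ChenStein.
Context {R : realFieldType} {O T : finType} (W : O -> R).
Context (A : {set T}) (Ind : T -> O -> bool) (N : rel T).

Definition ind_count (g : O) : nat := (\sum_(t in A) Ind t g)%N.
(** The part of the sum made of indices that are not neighbours of [t]; [Ind_far] below states its
    independence from [Ind t]. *)
Definition far_count (t : T) (g : O) : nat :=
  (\sum_(t' in A | ~~ N t t') Ind t' g)%N.
Definition near_count (t : T) (g : O) : nat :=
  (\sum_(t' in A | N t t') Ind t' g)%N.

Lemma ind_count_near_far t g :
  ind_count g = (far_count t g + near_count t g)%N.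
Proof. by rewrite /ind_count (bigID (N t)) /= addnC. Qed.

Lemma natr_near_count t g :
  (near_count t g)%:R = \sum_(t' in [set t' in A | N t t']) (Ind t' g)%:R :> R.
Proof. by rewrite natr_sum; apply: eq_bigl => t'; rewrite inE. Qed.

(** The difference vanishes for [k = 0] and is at most [2 * B] otherwise. This crude form lets a sup
    bound on [f] stand in for a bound on its increments. *)
Lemma bounded_increment (f : nat -> R) B : (forall k, `|f k| <= B) ->
  forall m k, `|f (m + k)%N - f m| <= 2 * B * k%:R.
Proof.
move=> fB m [|k]; first by rewrite addn0 subrr normr0 mulr0.
have B0 : 0 <= B by apply: le_trans (fB 0%N).
apply: le_trans (ler_normB _ _) _.
apply: le_trans (lerD (fB _) (fB _)) _.
rewrite (_ : B + B = 2 * B * 1); last by ring.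
by apply: ler_wpM2l; rewrite ?mulr_ge0 // ler1n.
Qed.

Hypothesis W_ge0 : forall g, 0 <= W g.
Hypothesis W_sum1 : \sum_g W g = 1.
Hypothesis N_refl : forall t, N t t.
Hypothesis Ind_far : forall t, t \in A -> forall F : nat -> R,
  expect W (fun g => (Ind t g)%:R * F (far_count t g)) =
  expect W (fun g => (Ind t g)%:R) * expect W (fun g => F (far_count t g)).

Let p t : R := expect W (fun g => (Ind t g)%:R).
Let pp t t' : R := expect W (fun g => (Ind t g)%:R * (Ind t' g)%:R).

(** Both expectations are compared with the same quantity: by [Ind_far], [p t] times the mean of
    [f (far_count t g).+1] is the mean of that value on [Ind t]. The remaining increments count
    neighbours only. *)
Lemma chen_stein_term (f : nat -> R) B t : (forall k, `|f k| <= B) ->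
  t \in A ->
  `|p t * expect W (fun g => f (ind_count g).+1) -
    expect W (fun g => (Ind t g)%:R * f (ind_count g))| <=
  2 * B * (p t * (\sum_(t' in [set t' in A | N t t']) p t') +
           \sum_(t' in [set t' in A | N t t' && (t' != t)]) pp t t').
Proof.
move=> fB tA.
have fD := bounded_increment fB.
have p_ge0 : 0 <= p t.
  by apply: sumr_ge0 => g _; rewrite mulr_ge0 // ler0n.
have -> : p t * expect W (fun g => f (ind_count g).+1) -
    expect W (fun g => (Ind t g)%:R * f (ind_count g)) =
    p t * expect W (fun g => f (ind_count g).+1 - f (far_count t g).+1) -
    expect W (fun g => (Ind t g)%:R *
      (f (ind_count g) - f (far_count t g).+1)).
  rewrite expectB.
  under [in RHS](eq_expect _ (F := fun g => (Ind t g)%:R * _))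
    do rewrite mulrBr.
  rewrite expectB (Ind_far tA (fun k => f k.+1)) -/(p t); ring.
apply: le_trans (ler_normB _ _) _; rewrite mulrDr; apply: lerD.
  rewrite normrM (ger0_norm p_ge0) mulrCA; apply: ler_wpM2l => //.
  rewrite /p -expect_sum -expectZ; apply: norm_expect_le => // g.
  rewrite (ind_count_near_far t) -natr_near_count -addSn; exact: fD.
rewrite -expect_sum -expectZ; apply: norm_expect_le => // g.
case: (boolP (Ind t g)) => [It|_]; last first.
  rewrite !mul0r normr0 mulr_ge0 //.
    by rewrite mulr_ge0 //; apply: le_trans (fB 0%N).
  by apply: sumr_ge0 => t' _; rewrite mul0r.
rewrite mul1r (ind_count_near_far t).
(* On [Ind t], the index [t] is its own neighbour and accounts for the successor in
   [(far_count t g).+1]; only the other neighbours are left in the increment. *)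
have -> : near_count t g =
    (\sum_(t' in A | N t t' && (t' != t)) Ind t' g).+1.
  rewrite /near_count (bigD1 t) /= ?tA ?N_refl // It add1n; congr _.+1.
  by apply: eq_bigl => t'; rewrite andbA.
rewrite addnS -addSn; apply: le_trans (fD _ _) _; rewrite natr_sum.
rewrite le_eqVlt; apply/orP; left; apply/eqP; congr (_ * _).
by apply: eq_big => [t'|t' _]; rewrite ?inE ?mul1r.
Qed.

(** Replacing [lambda] by the mean of the count costs the first term; the rest splits over [t] into
    the differences bounded by [chen_stein_term]. *)
Lemma chen_stein (f : nat -> R) B lambda : (forall k, `|f k| <= B) ->
  `|expect W (fun g => lambda * f (ind_count g).+1 -
                       (ind_count g)%:R * f (ind_count g))| <=
  B * `|lambda - \sum_(t in A) p t| +
  2 * B * \sum_(t in A) (p t * (\sum_(t' in [set t' in A | N t t']) p t') +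
           \sum_(t' in [set t' in A | N t t' && (t' != t)]) pp t t').
Proof.
move=> fB; rewrite expectB expectZ.
have -> : expect W (fun g => (ind_count g)%:R * f (ind_count g)) =
    \sum_(t in A) expect W (fun g => (Ind t g)%:R * f (ind_count g)).
  rewrite -expect_sum; apply: eq_expect => g.
  by rewrite -mulr_suml natr_sum.
set Ef := expect W _.
have -> : lambda * Ef -
    \sum_(t in A) expect W (fun g => (Ind t g)%:R * f (ind_count g)) =
    (lambda - \sum_(t in A) p t) * Ef + \sum_(t in A) (p t * Ef -
       expect W (fun g => (Ind t g)%:R * f (ind_count g))).
  by rewrite sumrB -mulr_suml; ring.
apply: le_trans (ler_normD _ _) _; apply: lerD.
  rewrite normrM mulrC ler_wpM2r // -(expect_cst W_sum1 B).
  exact: norm_expect_le.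
apply: le_trans (ler_norm_sum _ _ _) _; rewrite mulr_sumr.
by apply: ler_sum => t tA; exact: chen_stein_term.
Qed.

End ChenStein.

(** * Independent coordinates on a finite product space *)

Section ProductExpectation.
Context {R : realFieldType} {I K : finType} (q : K -> R).

Definition prod_weight (g : {ffun I -> K}) : R := \prod_i q (g i).

Hypothesis q_ge0 : forall k, 0 <= q k.
Hypothesis q_sum1 : \sum_k q k = 1.

Lemma prod_weight_ge0 g : 0 <= prod_weight g.
Proof. by apply: prodr_ge0 => i _. Qed.

Lemma sum_prod_weight : \sum_g prod_weight g = 1.
Proof. by rewrite -(bigA_distr_bigA (fun=> q)) big1. Qed.

Definition set_coord (g : {ffun I -> K}) i k : {ffun I -> K} :=
  [ffun j => if j == i then k else g j].

(** The weight of the pair [(g, k)] is unchanged when [k] and the coordinate [g i] are exchanged.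
    The product form avoids dividing by [q (g i)], which may vanish. *)
Lemma prod_weight_set_coord g i k :
  prod_weight (set_coord g i k) * q (g i) = prod_weight g * q k.
Proof.
rewrite /prod_weight (bigD1 i) //= [in RHS](bigD1 i) //= ffunE eqxx.
rewrite mulrAC [RHS]mulrAC; congr (_ * _); first by rewrite mulrC.
by apply: eq_bigr => j /negbTE ji; rewrite ffunE ji.
Qed.

(* Resampling the coordinate [i] independently leaves the law unchanged. *)
Lemma expect_coord (i : I) (u : K -> R) (G : {ffun I -> K} -> R) :
  (forall g h : {ffun I -> K}, (forall j, j != i -> g j = h j) -> G g = G h) ->
  expect prod_weight (fun g => u (g i) * G g) =
  (\sum_k q k * u k) * expect prod_weight G.
Proof.
(* An extra sample of law [q] is adjoined, and the involution [sw] exchanges it with the coordinate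
   [i]. *)
move=> Gi; pose sw (x : {ffun I -> K} * K) := (set_coord x.1 i x.2, x.1 i).
have swK : involutive sw.
  move=> [g k]; rewrite /sw /= ffunE eqxx; congr pair.
  by apply/ffunP => j; rewrite !ffunE; case: eqP => // ->.
rewrite -[LHS]mulr1 -q_sum1 /expect mulr_suml [RHS]mulrC mulr_suml.
under eq_bigr do rewrite mulr_sumr.
under [RHS]eq_bigr do rewrite mulr_sumr.
rewrite !pair_bigA /= (reindex_inj (inv_inj swK)) /=.
apply: eq_bigr => -[g k] _ /=; rewrite ffunE eqxx.
rewrite (Gi (set_coord g i k) g); last first.
  by move=> j /negbTE ji; rewrite ffunE ji.
by rewrite mulrAC prod_weight_set_coord; ring.
Qed.

(** The coordinates are integrated out one at a time with [expect_coord]. Labels [s] are kept apart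
    from coordinates [x s] because the test [u s] will depend on the position in a progression. *)
Lemma expect_coords (S : Type) (ss : seq S) (x : S -> I) (u : S -> K -> R)
    (G : {ffun I -> K} -> R) :
  uniq (map x ss) ->
  (forall g h : {ffun I -> K}, (forall j, j \notin map x ss -> g j = h j) -> G g = G h) ->
  expect prod_weight (fun g => (\prod_(s <- ss) u s (g (x s))) * G g) =
  (\prod_(s <- ss) \sum_k q k * u s k) * expect prod_weight G.
Proof.
elim: ss => [|s ss IH] /= in G * => [_ _|/andP[xs uss] Gss].
  by rewrite big_nil mul1r; apply: eq_expect => g; rewrite big_nil mul1r.
under eq_expect do rewrite big_cons -mulrA.
rewrite expect_coord => [|g h gh].
  rewrite IH ?big_cons ?mulrA // => g h gh; apply: Gss => j.
  by rewrite inE negb_or => /andP[_ /gh].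
congr (_ * _); last first.
  by apply: Gss => j; rewrite inE negb_or => /andP[/gh].
elim: ss xs {IH uss Gss} => [|s' ss IH]; first by rewrite !big_nil.
rewrite /= inE negb_or => /andP[ss' /IH e]; rewrite !big_cons e gh //.
by rewrite eq_sym.
Qed.

End ProductExpectation.

(** * Counting arithmetic progressions *)

Section Progressions.
Local Open Scope nat_scope.

Definition APs r n : {set r.-tuple 'I_n} := [set t | `[< is_AP t >]].

Lemma APsP r n (t : r.-tuple 'I_n) : reflect (is_AP t) (t \in APs r n).
Proof. by rewrite inE; exact: asboolP. Qed.

Lemma AP_inj r n (t t' : r.-tuple 'I_n) (s1 s2 : 'I_r) :
  t \in APs r n -> t' \in APs r n -> s1 != s2 ->
  tnth t s1 = tnth t' s1 -> tnth t s2 = tnth t' s2 -> t = t'.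
Proof.
move=> /APsP[x [d [d0 te]]] /APsP[x' [d' [d'0 te']]] s12.
move=> /(congr1 val) /=; rewrite te te' => e1.
move=> /(congr1 val) /=; rewrite te te' => e2.
have {}s12 : (s1 != s2 :> nat) by [].
have dd : d = d'.
  case: (ltngtP d d') => //.
    by case: (ltngtP s1 s2) s12 => //; nia.
  by case: (ltngtP s1 s2) s12 => //; nia.
by apply: eq_from_tnth => s; apply: val_inj; rewrite /= te te'; subst; lia.
Qed.

Lemma AP_tnth_inj r n (t : r.-tuple 'I_n) :
  t \in APs r n -> injective (tnth t).
Proof.
move=> /APsP[x [d [d0 te]]] s s' /(congr1 val) /=; rewrite !te => e.
by apply: val_inj => /=; nia.
Qed.

(** The difference [d'] is a positive multiple of [d], and [r - 1] steps of [d'] must fit in the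
    span of [t], so [d' = d]; then both progressions start at the same element. *)
Lemma AP_sub r n (t t' : r.-tuple 'I_n) : 1 < r ->
  t \in APs r n -> t' \in APs r n ->
  (forall s, tnth t' s \in t) -> t' = t.
Proof.
case: r t t' => [|[|m]] // t t' _ /APsP[x [d [d0 te]]] /APsP[x' [d' [d'0 te']]].
move=> sub.
(* The second disjunct absorbs the out-of-range positions, so that [s] can be a plain integer. *)
have sub' s : exists2 u, u <= m.+1 & x' + s * d' = x + u * d \/ m.+1 < s.
  have [ms|sm] := leqP m.+2 s; first by exists 0; [|right].
  have /tnthP[u ue] := sub (Ordinal sm); exists u.
    by have := ltn_ord u; rewrite ltnS.
  by left; have := congr1 val ue; rewrite /= te te'.
have [u0 hu0 [e0|//]] := sub' 0.
have [u1 hu1 [e1|//]] := sub' 1.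
have [um hum [em|]] := sub' m.+1; last by rewrite ltnn.
have u01 : u0 < u1 by rewrite -(ltn_pmul2r d0); lia.
have dd' : d <= d' by nia.
have d'd : d' <= d.
  rewrite -(leq_pmul2l (ltn0Sn m)); apply: (@leq_trans (um * d)); first lia.
  by rewrite leq_mul2r hum orbT.
have {dd' d'd}dd : d' = d by apply/eqP; rewrite eqn_leq d'd.
subst d'; have um_eq : um = u0 + m.+1.
  by apply/eqP; rewrite -(eqn_pmul2r d0); apply/eqP; lia.
have u00 : u0 = 0 by lia.
apply: eq_from_tnth => s; apply: val_inj; rewrite /= te te'.
by rewrite u00 in e0; lia.
Qed.

Lemma card_le_cover (T J : finType) (B : {set T}) (Q : J -> pred T) m :
  (forall x, x \in B -> exists k, Q k x) ->
  (forall k, #|[set x in B | Q k x]| <= m) -> #|B| <= #|J| * m.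
Proof.
move=> BQ Qm; rewrite -sum1_card.
apply: (@leq_trans (\sum_(x in B) \sum_(k : J) Q k x)).
  apply: leq_sum => x /BQ[k Qk]; rewrite (bigD1 k) //= Qk; exact: leq_addr.
rewrite exchange_big /= -sum_nat_const; apply: leq_sum => k _.
apply: leq_trans (Qm k); rewrite -sum1_card big_mkcond /= [X in _ <= X]big_mkcond.
by apply: leq_sum => x _; rewrite inE; case: (x \in B) => //; case: (Q k x).
Qed.

(** Once the term at [s] is fixed, the term at any other position [s'] determines the
    progression. *)
Lemma card_APs_thru1 r n (s : 'I_r) (i : 'I_n) : 1 < r ->
  #|[set t in APs r n | tnth t s == i]| <= n.
Proof.
move=> r1; have [s' ss'] : exists s' : 'I_r, s != s'.
  have r0 : 0 < r by apply: leq_trans r1.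
  case: (eqVneq s (Ordinal r0)) => [->|]; last by exists (Ordinal r0).
  by exists (Ordinal r1).
rewrite -[X in _ <= X]card_ord -(card_in_imset (f := fun t => tnth t s')).
  exact: max_card.
move=> t t' /finset.setIdP[tA /eqP ti] /finset.setIdP[tA' /eqP ti'] e.
by apply: (AP_inj tA tA' ss') => //; rewrite ti ti'.
Qed.

Lemma card_APs_thru2 r n (s1 s2 : 'I_r) (i j : 'I_n) : s1 != s2 ->
  #|[set t in APs r n | (tnth t s1 == i) && (tnth t s2 == j)]| <= 1.
Proof.
move=> s12; apply/card_le1_eqP => t t' /finset.setIdP[tA /andP[/eqP ti /eqP tj]].
move=> /finset.setIdP[tA' /andP[/eqP ti' /eqP tj']].
by apply: (AP_inj tA' tA s12); rewrite ?ti ?tj.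
Qed.

(** Positions in [t'] are recorded rather than common elements, so that the complement indexes the
    color constraints that [t'] adds to those of [t]. *)
Definition shared r n (t t' : r.-tuple 'I_n) : {set 'I_r} :=
  [set s | tnth t' s \in t].

Lemma card_APs_shared1 r n (t : r.-tuple 'I_n) : 1 < r ->
  #|[set t' in APs r n | shared t t' != finset.set0]| <= r ^ 2 * n.
Proof.
move=> r1; rewrite -mulnn -[X in X * X]card_ord -card_prod.
apply: (card_le_cover (Q := fun k t' => tnth t' k.1 == tnth t k.2)).
  move=> t'; rewrite inE => /andP[_ /set0Pn[s]]; rewrite inE => /tnthP[s' e].
  by exists (s, s'); rewrite /= e.
move=> [s s'] /=; apply: leq_trans (card_APs_thru1 s (tnth t s') r1).
apply: subset_leq_card; apply/fintype.subsetP => t'.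
by rewrite !inE => /andP[/andP[-> _] ->].
Qed.

(** Two coincidences are described by four positions, two in each progression, and then leave at
    most one choice of [t']. *)
Lemma card_APs_shared2 r n (t : r.-tuple 'I_n) :
  #|[set t' in APs r n | 1 < #|shared t t'|]| <= r ^ 4.
Proof.
rewrite -[r ^ 4]muln1 (_ : r ^ 4 = #|{: ('I_r * 'I_r) * ('I_r * 'I_r)}|);
  last by rewrite !card_prod card_ord -!mulnA.
apply: (card_le_cover (Q := fun k t' => [&& k.1.1 != k.2.1,
  tnth t' k.1.1 == tnth t k.1.2 & tnth t' k.2.1 == tnth t k.2.2])).
  move=> t'; rewrite inE => /andP[_ /card_gt1P[s1 [s2]]].
  rewrite !inE => -[/tnthP[s1' e1] /tnthP[s2' e2] s12].
  by exists ((s1, s1'), (s2, s2')); rewrite /= s12 e1 e2 !eqxx.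
move=> [[s1 s1'] [s2 s2']] /=; case: (boolP (s1 != s2)) => [s12|_]; last first.
  by rewrite (_ : finset _ = finset.set0) ?cards0 //;
    apply/setP => t'; rewrite !inE andbF.
apply: leq_trans (card_APs_thru2 (tnth t s1') (tnth t s2') s12).
apply: subset_leq_card; apply/fintype.subsetP => t'.
by rewrite !inE => /andP[/andP[-> _] ->].
Qed.

Lemma mkAP_subproof n m (yd : 'I_n * 'I_n) (s : 'I_m.+1) :
  yd.1 - (m - s) * yd.2 < n.
Proof. exact: leq_ltn_trans (leq_subr _ _) (ltn_ord _). Qed.

(* A progression is encoded by its last term and its common difference. *)
Definition mkAP n m (yd : 'I_n * 'I_n) : m.+1.-tuple 'I_n :=
  [tuple Ordinal (mkAP_subproof yd s) | s < m.+1].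

(** With last term [y], the possible differences are the [d] with [0 < d] and [m * d <= y]. *)
Lemma card_APs n m : 0 < m -> #|APs m.+1 n| = \sum_(y < n) y %/ m.
Proof.
move=> m0; pose D : {set 'I_n * 'I_n} :=
  finset (fun yd : 'I_n * 'I_n => (0 < yd.2) && (m * yd.2 <= yd.1)).
have -> : APs m.+1 n = (mkAP m @: D)%SET.
  apply/setP => t; apply/APsP/imsetP.
    move=> [x [d [d0 te]]].
    have ye : tnth t ord_max = x + m * d :> nat by rewrite te.
    have dn : d < n by apply: leq_ltn_trans (ltn_ord (tnth t ord_max)); nia.
    exists (tnth t ord_max, Ordinal dn); first by rewrite inE /= d0 ye; nia.
    apply: eq_from_tnth => s; apply: val_inj; rewrite tnth_mktuple /= te ye.
    have : s * d <= m * d by rewrite leq_mul2r -ltnS ltn_ord orbT.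
    by rewrite mulnBl; lia.
  move=> [[y d]]; rewrite inE /= => /andP[d0 md] ->.
  exists (y - m * d), d; split=> // s; rewrite tnth_mktuple /=.
  have : s * d <= m * d by rewrite leq_mul2r -ltnS ltn_ord orbT.
  by rewrite mulnBl; lia.
rewrite card_in_imset; last first.
  move=> [y d] [y' d']; rewrite !inE /= => /andP[d0 md] /andP[d0' md'] e.
  have em := congr1 (fun t => val (tnth t ord_max)) e.
  have e0 := congr1 (fun t => val (tnth t ord0)) e.
  rewrite /= !tnth_mktuple /= subnn !mul0n !subn0 in em e0.
  by congr pair; apply: val_inj => //=; nia.
rewrite -sum1_card (eq_bigl (fun yd : 'I_n * 'I_n => true && ((0 < yd.2) && (m * yd.2 <= yd.1))));
  last by move=> yd; rewrite inE.
rewrite -(pair_big_dep predT (fun y d : 'I_n => (0 < d) && (m * d <= y))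
  (fun _ _ => 1)) /=.
apply: eq_bigr => y _.
rewrite -(big_mkord (fun d => (0 < d) && (m * d <= y)) (fun=> 1)).
rewrite (eq_bigl (fun d => (0 < d) && (d < (y %/ m).+1))); last first.
  by move=> d; rewrite ltnS leq_divRL // mulnC.
rewrite -big_nat_widen; last first.
  exact: leq_ltn_trans (leq_div _ _) (ltn_ord y).
rewrite big_mkcond big_nat_recl //= add0n.
by rewrite sum_nat_const_nat subn0 muln1.
Qed.

Lemma card_APs_bounds n m : 0 < m ->
  2 * m * #|APs m.+1 n| <= n ^ 2 <= 2 * m * #|APs m.+1 n| + 3 * m * n.
Proof.
move=> m0; rewrite card_APs // -mulnn.
(* The induction on [n] rests on [m * (n %/ m) <= n < m * (n %/ m) + m]. The error [2 * m * n + n]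
   is at most [3 * m * n] as [0 < m]. *)
have : (2 * m * (\sum_(y < n) y %/ m) + n <= n * n) /\
  (n * n <= 2 * m * (\sum_(y < n) y %/ m) + 2 * m * n + n).
  elim: n => [|n [IH1 IH2]]; first by rewrite big_ord0 !muln0.
  rewrite !big_ord_recr /=.
  set S := (\sum_(i < n) _)%N in IH1 IH2 *.
  have nE : n = m * (n %/ m) + n %% m by rewrite mulnC -divn_eq.
  have := ltn_pmod n m0; move: (n %/ m) (n %% m) nE => q e nE em.
  by rewrite !mulnDr mulSn !mulnS; split; lia.
by move=> [h1 h2]; apply/andP; split; nia.
Qed.

End Progressions.

(** * The Stein equation of the Poisson law *)

Section Stein.
Context {R : realType}.
Implicit Type lambda : R.

Lemma cvg_poisson_sum lambda (A : set nat) : 0 < lambda ->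
  (\sum_(0 <= j < M) (j \in A)%:R * poisson_pmf lambda j) @[M --> \oo] -->
  fine (Pois lambda A).
Proof.
move=> l0; pose u j : \bar R := (poisson_pmf lambda j)%:E.
have u0 j : (0 <= u j)%E by rewrite lee_fin poisson_pmf_ge0.
have PoisE : Pois lambda A = (\sum_(i <oo | i \in A) u i)%E.
  rewrite nneseries_esum // (_ : [set x | x \in A] = A) ?set_mem_set //.
  by rewrite /= /Pois /= /poisson_prob l0.
have cv : ((\sum_(0 <= i < M | i \in A) u i)%E @[M --> \oo] -->
    Pois lambda A).
  by rewrite PoisE; apply: is_cvg_nneseries.
apply: (fine_cvg (f := fun M =>
  (\sum_(0 <= j < M) (j \in A)%:R * poisson_pmf lambda j)%:E)).
rewrite fineK; last exact: fin_num_measure.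
apply: cvg_trans cv; apply: near_eq_cvg; near=> M.
rewrite -sumEFin [LHS]big_mkcond; apply: eq_bigr => j _.
by rewrite /u /=; case: ifP => _; rewrite ?mul1r ?mul0r.
Unshelve. all: by end_near.
Qed.

(** Up to the factor [expR lambda], this is the Poisson mass of [A] below [k] minus [Pois lambda A]
    times the total mass below [k]. *)
Definition stein_sum lambda (A : set nat) (k : nat) : R :=
  \sum_(0 <= j < k)
    lambda ^+ j / j`!%:R * ((j \in A)%:R - fine (Pois lambda A)).

(** The value at [0] is [0], the sum being empty, whatever [0.-1] is. *)
Definition stein_sol lambda (A : set nat) (k : nat) : R :=
  stein_sum lambda A k * (k.-1)`!%:R / lambda ^+ k.

(** Both terms on the left carry the factor [k! / lambda ^ k] when [0 < k], so their difference
    isolates the last summand of [stein_sum lambda A k.+1]. *)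
Lemma stein_eq lambda A k : 0 < lambda ->
  lambda * stein_sol lambda A k.+1 - k%:R * stein_sol lambda A k =
  (k \in A)%:R - fine (Pois lambda A).
Proof.
move=> l0; rewrite /stein_sol /stein_sum big_nat_recr //= -/(stein_sum _ _ k).
have l_neq0 : lambda != 0 by rewrite gt_eqF.
case: k => [|k] /=.
  by rewrite /stein_sum big_nil expr0 expr1 fact0; field.
rewrite factS natrM !exprS; have kf : (k`!)%:R != 0 :> R.
  by rewrite pnatr_eq0 -lt0n fact_gt0.
have lk : lambda ^+ k != 0 by rewrite expf_neq0.
have k1 : k.+1%:R != 0 :> R by rewrite pnatr_eq0.
by field; rewrite lk l_neq0 kf nat1r k1.
Qed.

(** The mass of [A] below [M] tends to [Pois lambda A] and the total mass below [M] tends to [1], so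
    the two parts cancel in the limit. *)
Lemma cvg_stein_sum lambda A : 0 < lambda ->
  stein_sum lambda A M @[M --> \oo] --> (0 : R).
Proof.
move=> l0; have cA := @cvg_poisson_sum lambda A l0.
have cT := @cvg_poisson_sum lambda setT l0.
have P1 : Pois lambda setT = 1%E by exact: probability_setT.
rewrite P1 /= in cT.
have : expR lambda * ((\sum_(0 <= j < M) (j \in A)%:R * poisson_pmf lambda j) -
   fine (Pois lambda A) *
   (\sum_(0 <= j < M) (j \in setT)%:R * poisson_pmf lambda j))
   @[M --> \oo] --> expR lambda * (fine (Pois lambda A) -
      fine (Pois lambda A) * 1).
  apply: cvgM; first exact: cvg_cst.
  by apply: cvgB cA _; apply: cvgM => //; exact: cvg_cst.
rewrite mulr1 subrr mulr0; apply: cvg_trans; apply: near_eq_cvg; near=> M.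
rewrite mulr_sumr -sumrB mulr_sumr; apply: eq_bigr => j _.
rewrite /poisson_pmf l0 in_setT expRN /=.
by field; rewrite gt_eqF ?ltr0n ?fact_gt0 // gt_eqF ?expR_gt0.
Unshelve. all: by end_near.
Qed.

(* The partial sums tend to [0], hence each is bounded by a tail of the
   exponential series, whose terms [w j] satisfy [w j <= 2 (w j - w (j+1))]. *)
Lemma stein_sum_le lambda A k : 0 < lambda -> lambda <= 1 / 2 ->
  `|stein_sum lambda A k| <= 2 * (lambda ^+ k / k`!%:R).
Proof.
move=> l0 l2; pose w j := lambda ^+ j / j`!%:R.
have w0 j : 0 <= w j by rewrite divr_ge0 // exprn_ge0 // ltW.
have wS j : w j <= 2 * (w j - w j.+1).
  (* The ratio of consecutive terms is [lambda / j.+1], at most [1 / 2]. *)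
  suff : 2 * w j.+1 <= w j by lra.
  have -> : w j.+1 = w j * (lambda / j.+1%:R).
    rewrite /w factS natrM exprS; field.
    by rewrite nat1r !pnatr_eq0 -!lt0n fact_gt0.
  rewrite mulrCA -[X in _ <= X]mulr1 ler_wpM2l //.
  rewrite mulrA ler_pdivrMr ?ltr0n // mul1r.
  by apply: (@le_trans _ _ 1); [lra | rewrite ler1n].
have piA01 : 0 <= fine (Pois lambda A) <= 1.
  rewrite fine_ge0 //= -lee_fin fineK; last exact: fin_num_measure.
  exact: probability_le1.
have dist M : (k <= M)%N ->
    `|stein_sum lambda A M - stein_sum lambda A k| <= 2 * w k.
  move=> kM; rewrite /stein_sum (big_cat_nat (leq0n k) kM) //= addrAC subrr add0r.
  apply: le_trans (ler_norm_sum _ _ _) _.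
  apply: (@le_trans _ _ (\sum_(k <= j < M) (- (2 * w j.+1) - - (2 * w j)))).
    apply: ler_sum => j _; rewrite normrM (ger0_norm (w0 j)).
    apply: (@le_trans _ _ (w j)); last by have := wS j; lra.
    rewrite -[X in _ <= X]mulr1 ler_wpM2l //.
    by rewrite ler_norml; case: (j \in A) => /=; lra.
  by rewrite telescope_sumr //; have := w0 M; lra.
apply/ler_addgt0Pl => e e0.
have /cvgrPdist_le /(_ e e0) [M _ hM] := @cvg_stein_sum lambda A l0.
have := hM (maxn M k) (leq_maxl _ _); have := dist _ (leq_maxr M k).
rewrite sub0r normrN -/(w k).
set x := stein_sum _ _ (maxn _ _); set y := stein_sum _ _ _ => h1 h2.
have -> : y = x - (x - y) by ring.
by apply: le_trans (ler_normB _ _) _; lra.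
Qed.

(** For positive [k], the bound [stein_sum_le] times [(k - 1)! / lambda ^ k] equals [2 / k]. *)
Lemma stein_sol_le lambda A k : 0 < lambda -> lambda <= 1 / 2 ->
  `|stein_sol lambda A k| <= 2.
Proof.
move=> l0 l2; case: k => [|k]; first
  by rewrite /stein_sol /stein_sum big_nil !mul0r normr0.
have lk : 0 < lambda ^+ k.+1 by rewrite exprn_gt0.
rewrite /stein_sol normrM normfV normrM (gtr0_norm lk) (ger0_norm (ler0n _ _)).
rewrite ler_pdivrMr //; apply: le_trans (ler_wpM2r _ (stein_sum_le A _ l0 l2)) _.
  exact: ler0n.
rewrite -!mulrA ler_pM2l // ler_piMr ?(ltW lk) // factS natrM invfM.
rewrite -mulrA mulVf ?pnatr_eq0 -?lt0n ?fact_gt0 // mulr1.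
by rewrite invf_le1 ?ltr0n // ler1n.
Qed.

End Stein.

(** * Colorful progressions in a product space *)

Section ColorfulAPs.
Context {R : realType} {n r : nat} {K : finType} (q : K -> R)
  (e : 'I_r -> K -> bool).
Implicit Types (t : r.-tuple 'I_n) (g h : {ffun 'I_n -> K}).

Local Notation E := (expect (prod_weight q)).

Definition match_prob (s : 'I_r) : R := \sum_k q k * (e s k)%:R.

Definition matching t g : bool := [forall s, e s (g (tnth t s))].

Lemma natr_matching t g :
  (matching t g)%:R = \prod_s (e s (g (tnth t s)))%:R :> R.
Proof.
case: (boolP (matching t g)) => [/forallP h|].
  by rewrite big1 // => s _; rewrite h.
rewrite negb_forall => /existsP[s /negbTE es].
by rewrite (bigD1 s) //= es mul0r.
Qed.

Hypothesis r_gt1 : (1 < r)%N.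
Hypothesis q_ge0 : forall k, 0 <= q k.
Hypothesis q_sum1 : \sum_k q k = 1.

Lemma match_prob_ge0 s : 0 <= match_prob s.
Proof. by apply: sumr_ge0 => k _; rewrite mulr_ge0 // ler0n. Qed.

Lemma match_prob_le1 s : match_prob s <= 1.
Proof.
rewrite -q_sum1; apply: ler_sum => k _.
by case: (e s k); rewrite ?mulr1 // mulr0.
Qed.

(** The terms of a progression are distinct coordinates, so [expect_coords] integrates out all its
    tests. *)
Lemma expect_matching_mul t (G : {ffun 'I_n -> K} -> R) : t \in APs r n ->
  (forall g h, (forall j, j \notin t -> g j = h j) -> G g = G h) ->
  E (fun g => (matching t g)%:R * G g) = (\prod_s match_prob s) * E G.
Proof.
move=> tA Gt; under eq_expect do rewrite natr_matching.
rewrite (expect_coords (ss := index_enum 'I_r) (x := tnth t) q_sum1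
  (fun s k => (e s k)%:R)) //.
  by rewrite map_inj_uniq ?index_enum_uniq //; exact: AP_tnth_inj tA.
move=> g h gh; apply: Gt => j jt; apply: gh; apply: contra jt.
by move=> /mapP[s _ ->]; exact: mem_tnth.
Qed.

Lemma expect_matching t : t \in APs r n ->
  E (fun g => (matching t g)%:R) = \prod_s match_prob s.
Proof.
move=> tA; rewrite -[RHS]mulr1 -[X in _ = _ * X](expect_cst (sum_prod_weight (I := 'I_n) q_sum1) 1).
rewrite -(expect_matching_mul tA) //.
by apply: eq_expect => g; rewrite mulr1.
Qed.

(** The tests of [t'] at shared positions are bounded by [1] and dropped; the others read
    coordinates outside [t]. *)
Lemma expect_matching2 t t' : t \in APs r n -> t' \in APs r n ->
  E (fun g => (matching t g)%:R * (matching t' g)%:R) <=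
  (\prod_s match_prob s) * \prod_(s in ~: shared t t') match_prob s.
Proof.
move=> tA tA'; pose ss := enum (~: shared t t').
pose G (g : {ffun 'I_n -> K}) : R :=
  \prod_(s <- ss) (e s (g (tnth t' s)))%:R.
have EG : E G = \prod_(s in ~: shared t t') match_prob s.
  rewrite -[RHS]mulr1 -[X in _ = _ * X](expect_cst (sum_prod_weight (I := 'I_n) q_sum1) 1).
  rewrite -big_enum /= -(expect_coords (ss := ss) (x := tnth t') q_sum1
    (fun s k => (e s k)%:R)) //.
    by apply: eq_expect => g; rewrite mulr1.
  by rewrite map_inj_uniq ?enum_uniq //; exact: AP_tnth_inj tA'.
rewrite -EG -(expect_matching_mul tA); last first.
  move=> g h gh; apply: eq_big_seq => s; rewrite mem_enum inE inE => st.
  by rewrite gh.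
apply: expect_le => [g|g]; first exact: prod_weight_ge0.
rewrite ler_wpM2l ?ler0n //.
rewrite natr_matching /G big_enum /= [X in X <= _](bigID (mem (shared t t'))) /=.
have -> : \prod_(s in ~: shared t t') (e s (g (tnth t' s)))%:R =
    \prod_(s | s \notin shared t t') (e s (g (tnth t' s)))%:R :> R.
  by apply: eq_bigl => s; rewrite inE.
rewrite ler_piMl //; first by apply: prodr_ge0 => s _; rewrite ler0n.
by apply: prodr_ile1 => s _; case: (e s _); rewrite /= ?lexx ?ler01.
Qed.

Local Notation N := (fun t t' => shared t t' != finset.set0).

(** This is the hypothesis [Ind_far] of the Chen-Stein bound: progressions disjoint from [t] read no
    coordinate of [t]. *)
Lemma far_matching t (F : nat -> R) : t \in APs r n ->
  E (fun g => (matching t g)%:R * F (far_count (APs r n) matching N t g)) =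
  E (fun g => (matching t g)%:R) *
  E (fun g => F (far_count (APs r n) matching N t g)).
Proof.
move=> tA; rewrite expect_matching // expect_matching_mul // => g h gh.
congr F; apply: eq_bigr => t' /andP[tA' /negPn/eqP t't].
congr nat_of_bool; apply: eq_forallb => s; rewrite gh //.
by have := finset.in_set0 s; rewrite -t't inE => ->.
Qed.

Lemma near_pairs_le t alpha beta : t \in APs r n ->
  (forall s, \prod_(s' | s' != s) match_prob s' <= alpha) ->
  (forall s, match_prob s <= beta) ->
  \sum_(t' in [set t' in APs r n | N t t' && (t' != t)])
     E (fun g => (matching t g)%:R * (matching t' g)%:R) <=
  (\prod_s match_prob s) * ((r ^ 2 * n)%:R * alpha + (r ^ 4)%:R * beta).
Proof.
move=> tA ha hb.
have r0 : (0 < r)%N by exact: ltnW.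
have a0 : 0 <= alpha.
  apply: le_trans (ha (Ordinal r0)); apply: prodr_ge0 => s _.
  exact: match_prob_ge0.
have b0 : 0 <= beta by exact: le_trans (match_prob_ge0 (Ordinal r0)) _.
have Q0 : 0 <= \prod_s match_prob s.
  by apply: prodr_ge0 => s _; exact: match_prob_ge0.
(* Every neighbour is charged [alpha], and those with at least two shared positions also [beta], so
   that each cardinality bound applies to its own sum. *)
apply: (@le_trans _ _ (\sum_(t' in APs r n | N t t' && (t' != t))
    (\prod_s match_prob s) *
      (alpha + (1 < #|shared t t'|)%:R * beta))).
  rewrite [X in X <= _](eq_bigl
    (fun t' => (t' \in APs r n) && (N t t' && (t' != t)))); last first.
    by move=> t'; rewrite inE.
  apply: ler_sum => t' /andP[tA' /andP[tt' t't]].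
  apply: le_trans (expect_matching2 tA tA') _; apply: ler_wpM2l => //.
  case: ltnP => [_|card1].
    rewrite mul1r; apply: (@le_trans _ _ beta); last by rewrite lerDr.
    have [s hs] : exists s, tnth t' s \notin t.
      apply/existsP; rewrite -[X in is_true X]negbK negb_exists.
      apply: contra t't => /forallP sub; apply/eqP/AP_sub => // s.
      by have := sub s; rewrite negbK.
    rewrite (bigD1 s) /=; last by rewrite !inE.
    apply: le_trans (hb s); rewrite ler_piMr ?match_prob_ge0 //.
    by apply: prodr_ile1 => s' _; rewrite match_prob_ge0 match_prob_le1.
  rewrite mul0r addr0.
  have /cards1P[s ss] : #|shared t t'| == 1%N.
    by rewrite eqn_leq card1 card_gt0.
  apply: le_trans (ha s); rewrite le_eqVlt; apply/orP; left; apply/eqP.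
  by apply: eq_bigl => s'; rewrite ss !inE.
rewrite -mulr_sumr; apply: ler_wpM2l => //.
rewrite big_split /=; apply: lerD.
  rewrite sumr_const -[X in X <= _]mulr_natl ler_wpM2r // ler_nat.
  apply: leq_trans (card_APs_shared1 t r_gt1).
  apply: subset_leq_card; apply/fintype.subsetP => t'.
  by rewrite unfold_in => /andP[tA' /andP[tt' _]]; apply/finset.setIdP.
rewrite -mulr_suml ler_wpM2r // -natr_sum ler_nat.
apply: leq_trans (card_APs_shared2 t); rewrite -sum1_card.
rewrite big_mkcond [X in (_ <= X)%N]big_mkcond /=.
apply: leq_sum => t' _; rewrite [in X in (_ <= X)%N]inE.
case: (t' \in _) => //=; case: (_ && _) => //=.
Qed.

(** The Chen-Stein bound applied to [stein_sol lambda A]; the constants [2] and [4] are [B] and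
    [2 * B] with [B = 2] from [stein_sol_le]. *)
Lemma poisson_approx (lambda alpha beta : R) (A : set nat) :
  0 < lambda -> lambda <= 1 / 2 ->
  (forall s, \prod_(s' | s' != s) match_prob s' <= alpha) ->
  (forall s, match_prob s <= beta) ->
  `|E (fun g => (ind_count (APs r n) matching g \in A)%:R) -
    fine (Pois lambda A)| <=
  2 * `|lambda - #|APs r n|%:R * \prod_s match_prob s| +
  4 * (#|APs r n|%:R * (\prod_s match_prob s) *
    ((r ^ 2 * n)%:R * (\prod_s match_prob s + alpha) + (r ^ 4)%:R * beta)).
Proof.
move=> l0 l2 ha hb; set Q := \prod_s match_prob s.
have Q0 : 0 <= Q by apply: prodr_ge0 => s _; exact: match_prob_ge0.
rewrite -[X in _ - X](expect_cst (sum_prod_weight (I := 'I_n) q_sum1)) -expectB.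
under eq_expect do rewrite -stein_eq //.
apply: le_trans (chen_stein (N := N) (B := 2) _ _ _ _ _ _) _.
- by move=> g; exact: prod_weight_ge0.
- exact: sum_prod_weight.
- move=> t; apply/set0Pn; exists (Ordinal (ltnW r_gt1)).
  by rewrite inE mem_tnth.
- by move=> t tA F; exact: far_matching.
- by move=> k; exact: stein_sol_le.
have EQ : {in APs r n, forall t, E (fun g => (matching t g)%:R) = Q}.
  by move=> t tA; exact: expect_matching.
rewrite (eq_bigr (fun=> Q)) // sumr_const -[Q *+ _]mulr_natl lerD2l.
rewrite (_ : 2 * 2 = 4); last by ring.
rewrite ler_pM2l ?ltr0n //; apply: (@le_trans _ _ (\sum_(t in APs r n)
  Q * ((r ^ 2 * n)%:R * (Q + alpha) + (r ^ 4)%:R * beta))); last first.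
  by rewrite sumr_const -[X in X <= _]mulr_natl mulrA.
apply: ler_sum => t tA; rewrite EQ //.
(* The summand with [Q] pays for the products of probabilities, the summands with [alpha] and [beta]
   for the joint probabilities. *)
rewrite (mulrDr (r ^ 2 * n)%:R) -addrA mulrDr; apply: lerD.
  rewrite ler_wpM2l // (eq_bigr (fun=> Q)); last first.
    by move=> t'; rewrite inE => /andP[tA' _]; exact: EQ.
  rewrite sumr_const -[X in X <= _]mulr_natl ler_wpM2r // ler_nat.
  exact: card_APs_shared1.
exact: near_pairs_le.
Qed.

End ColorfulAPs.

(** * From random colorings to a product space *)

Section RandomColoring.
Context {R : realType} {r n c : nat} {a : r.-tuple nat} {theta : nat -> R}
  {d : measure_display} {Omega : measurableType d} {P : probability Omega R}
  {phi : 'I_n -> {RV P >-> nat}}.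
Hypothesis phi_random : random_coloring c theta phi.

(* The color [b] in [1, c] is represented by [b - 1] in ['I_c]. *)
Definition color_weight (k : 'I_c) : R := color_prob c theta n k.+1.

Definition color_match (s : 'I_r) (k : 'I_c) : bool := k.+1 == tnth a s.

Lemma num_colorful_ind_count (g : {ffun 'I_n -> 'I_c}) :
  num_colorful a (fun i => (g i).+1) =
  ind_count (APs r n) (matching color_match) g.
Proof.
rewrite /num_colorful -sum1_card big_mkcondr /= /ind_count.
apply: eq_big => [t|t _]; first by rewrite inE.
by rewrite /colorful /matching /color_match; case: ifP.
Qed.

(** The event is the disjoint union, over finitely many full colorings [g], of the events [B g],
    whose probabilities factor by independence. *)
Lemma distribution_colorful_count (A : set nat) :
  distribution P (colorful_count a phi) A =
  (expect (prod_weight color_weight) (fun g =>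
     (ind_count (APs r n) (matching color_match) g \in A)%:R))%:E.
Proof.
have [rng prb ind] := phi_random.
pose B (g : {ffun 'I_n -> 'I_c}) : set Omega :=
  \bigcap_(i in [set` [set: 'I_n]%SET]) (phi i @^-1` [set (g i).+1]).
have mB g : measurable (B g).
  apply: fin_bigcap_measurable => // i _.
  by rewrite -[X in measurable X]setTI; exact: measurable_funPT.
have PB g : P (B g) = (prod_weight color_weight g)%:E.
  rewrite /B (ind _ (fun i => [set (g i).+1])) // -prodEFin.
  by apply: eq_big => [i|i _]; rewrite ?inE // prb //= ltn_ord.
pose D (g : {ffun 'I_n -> 'I_c}) : bool :=
  ind_count (APs r n) (matching color_match) g \in A.
rewrite /distribution /pushforward.
have -> : colorful_count a phi @^-1` A = \bigcup_(g in [set` D]) B g.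
  apply/seteqP; split => [w /= Aw|w [g Dg Bg]].
    have lt i : ((phi i w).-1 < c)%N.
      by have /andP[p1 pc] := rng i w; rewrite prednK.
    pose g : {ffun 'I_n -> 'I_c} := [ffun i => Ordinal (lt i)].
    have gE i : (g i).+1 = phi i w.
      by rewrite ffunE /= prednK //; have /andP[] := rng i w.
    exists g; last by move=> i _ /=; rewrite gE.
    rewrite /= /in_mem /= /D -num_colorful_ind_count; apply/mem_set.
    by rewrite (_ : (fun i => (g i).+1) = phi ^~ w) //; apply/funext => i.
  have gE : (fun i => (g i).+1) = phi ^~ w.
    by apply/funext => i; rewrite (Bg i) //= inE.
  by move: Dg; rewrite /= /in_mem /= /D -num_colorful_ind_count gE => /set_mem.
rewrite measure_fin_bigcup //; last first.
- move=> g h _ _ [w [gw hw]]; apply/ffunP => i; apply: val_inj.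
  have gi : phi i w = (g i).+1 by apply: gw; rewrite /= inE.
  have hi : phi i w = (h i).+1 by apply: hw; rewrite /= inE.
  exact: succn_inj (etrans (esym gi) hi).
rewrite -(bigfs _ (r := index_enum {ffun 'I_n -> 'I_c}) (P := D)); first last.
- by move=> g _; rewrite mem_index_enum.
- exact: index_enum_uniq.
rewrite /expect -sumEFin big_mkcond; apply: eq_bigr => g _.
by rewrite -/(D g); case: (D g); rewrite ?mulr1 ?mulr0 //; exact: PB.
Qed.

(** The formula for the last color has no evident sign; the weight is nonnegative as the probability
    of an event about [phi i]. *)
Lemma color_weight_ge0 (i : 'I_n) k : 0 <= color_weight k.
Proof.
have [_ prb _] := phi_random.
by rewrite -lee_fin -(prb i) //= ltn_ord.
Qed.

End RandomColoring.

Lemma sum_color_weight (R : realType) (c n : nat) (theta : nat -> R) :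
  (0 < c)%N -> \sum_(k < c) color_weight (n := n) (theta := theta) k = 1.
Proof.
case: c => // c _; rewrite big_ord_recr /= /color_weight /color_prob ltnn.
rewrite big_add1 big_mkord -[RHS](subrK (\sum_(i < c) n%:R `^ (- theta i.+1))).
rewrite addrC; congr (_ + _); apply: eq_bigr => k _ /=.
by rewrite ltnS ltn_ord.
Qed.

(** A single color passes the test, and admissibility keeps it below [c], in the power branch of
    [color_prob]. *)
Lemma match_prob_color (R : realType) (r c n : nat) (a : r.-tuple nat)
    (theta : nat -> R) (s : 'I_r) : admissible c a ->
  match_prob (color_weight (c := c) (n := n) (theta := theta))
    (color_match (a := a)) s = n%:R `^ (- theta (tnth a s)).
Proof.
move=> /(_ s) /andP[a1 ac].
have a_lt : ((tnth a s).-1 < c)%N by lia.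
rewrite /match_prob (bigD1 (Ordinal a_lt)) //= big1 ?addr0 => [|k].
  rewrite /color_match /color_weight /= prednK // eqxx mulr1 /color_prob.
  by case: ifP => //; lia.
rewrite -val_eqE /color_match /= => ks.
by rewrite (_ : (_ == _) = false) ?mulr0 //; apply/negbTE; lia.
Qed.

Lemma prod_powR (R : realType) (I : Type) (s : seq I) (Q : pred I) (x : R)
    (F : I -> R) : 0 < x ->
  \prod_(i <- s | Q i) x `^ F i = x `^ (\sum_(i <- s | Q i) F i).
Proof.
move=> x0; apply: (big_ind2 (fun u v => u = x `^ v)) => //; first by rewrite powRr0.
by move=> _ u _ v -> ->; rewrite powRD // (gt_eqF x0) implybT.
Qed.

Lemma sum_weight_theta (R : realType) r (a : r.-tuple nat) (theta : nat -> R) :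
  \sum_(b <- colors a) (weight a b)%:R * theta b = \sum_s theta (tnth a s).
Proof.
rewrite -(big_tuple _ _ a predT theta) -(big_undup_iterop_count _ a predT theta).
by apply: eq_bigr => b _; rewrite mulr_natl.
Qed.

(** * Total variation estimate *)

Lemma cvg_natr_powRN (R : realType) (s : R) : 0 < s ->
  n%:R `^ (- s) @[n --> \oo] --> (0 : R).
Proof.
move=> s0; apply/cvgr0Pnorm_le => e e0.
(* The threshold solves [n ^ (- s) = e] for [n]. *)
have /cvgryPge /(_ (e^-1 `^ s^-1)) := @cvgr_idn R.
apply: filterS => n hn.
have v0 : 0 < e^-1 by rewrite invr_gt0.
rewrite ger0_norm ?powR_ge0 // powRN invf_ple ?posrE //; last first.
  by rewrite powR_gt0 //; apply: lt_le_trans hn; rewrite powR_gt0.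
have -> : e^-1 = (e^-1 `^ s^-1) `^ s.
  by rewrite -powRrM mulVf ?lt0r_neq0 // powRr1 // ltW.
by apply: (ge0_ler_powR (ltW s0) _ _ hn); rewrite nnegrE ?powR_ge0.
Qed.

Section Theta.
Context {R : realType} {c r : nat} {a : r.-tuple nat} {theta : nat -> R}.
Hypothesis r_gt0 : (0 < r)%N.
Hypothesis a_adm : admissible c a.
Hypothesis theta_gt0 : forall b, (1 <= b <= c.-1)%N -> 0 < theta b.

Lemma theta_palette_gt0 b : b \in a -> 0 < theta b.
Proof. by move=> /tnthP[s ->]; exact: theta_gt0. Qed.

Lemma theta_min_gt0 : 0 < theta_min theta a.
Proof.
rewrite /theta_min big_seq; elim/big_ind: _ => [|x y x0 y0|b].
- by apply: theta_palette_gt0; rewrite -nth0 mem_nth // size_tuple.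
- by rewrite lt_min x0.
- by rewrite mem_undup; exact: theta_palette_gt0.
Qed.

Lemma theta_min_le s : theta_min theta a <= theta (tnth a s).
Proof. by apply: ge_bigmin_seq => //; rewrite mem_undup mem_tnth. Qed.

Lemma le_theta_max s : theta (tnth a s) <= theta_max theta a.
Proof. by apply: le_bigmax_seq => //; rewrite mem_undup mem_tnth. Qed.

Lemma theta_max_gt0 : 0 < theta_max theta a.
Proof.
apply: lt_le_trans (le_theta_max (Ordinal r_gt0)).
exact: theta_palette_gt0 (mem_tnth _ _).
Qed.

End Theta.

(** In the constant, [4] comes from the error on the mean, [8 * r ^ 2] from pairs bounded through
    [Q] and [alpha], and [4 * r ^ 4] from pairs with two common elements. *)
Lemma tv_colorful_count_le (R : realType) (r n c : nat) (a : r.-tuple nat)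
    (theta : nat -> R) (d : measure_display) (Omega : measurableType d)
    (P : probability Omega R) (phi : 'I_n -> {RV P >-> nat}) :
  (3 <= r)%N -> (0 < n)%N -> (0 < c)%N -> admissible c a ->
  (forall b, (1 <= b <= c.-1)%N -> 0 < theta b) ->
  \sum_(b <- colors a) (weight a b)%:R * theta b = 2 ->
  random_coloring c theta phi ->
  (tv_distance (distribution P (colorful_count a phi))
     (Pois (1 / (2 * (r - 1)%:R))) <=
   ((4 + 8 * r%:R ^+ 2 + 4 * r%:R ^+ 4) *
    Num.max (n%:R `^ (- 1 + theta_max theta a))
            (n%:R `^ (- theta_min theta a)))%:E)%E.
Proof.
move=> r3 n0 c0 adm th0 th2 rc; set lambda := 1 / _; set rho := Num.max _ _.
apply/ereal_supP => _ [A _ <-].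
rewrite [X in (`|X - _|)%E](distribution_colorful_count rc).
rewrite -(fineK (fin_num_measure (Pois lambda) A _)) // -EFinB lee_fin.
have r_gt1 : (1 < r)%N by exact: leq_trans r3.
have r_gt0 : (0 < r)%N by exact: ltnW.
pose m : R := (r - 1)%:R.
have m2 : 2 <= m by rewrite ler_nat; lia.
have l0 : 0 < lambda by rewrite divr_gt0 // mulr_gt0 //; lra.
have l2 : lambda <= 1 / 2.
  by rewrite ler_pdivrMr -/m ?mulr_gt0 //; lra.
pose x : R := n%:R.
have x1 : 1 <= x by rewrite ler1n.
have x0 : 0 < x by lra.
have mpE s := match_prob_color n theta s adm.
rewrite sum_weight_theta in th2.
have prodE : \prod_s match_prob
    (color_weight (c := c) (n := n) (theta := theta))
    (color_match (a := a)) s = x ^- 2.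
  under eq_bigr do rewrite mpE.
  by rewrite prod_powR // sumrN th2 powRN powR_mulrn ?ltW.
(* The exponents sum to [2] over all positions, and the omitted one is at most
   [theta_max theta a]. *)
have alpha_le s : \prod_(s' | s' != s) match_prob
    (color_weight (c := c) (n := n) (theta := theta))
    (color_match (a := a)) s' <= x `^ (- 2 + theta_max theta a).
  under eq_bigr do rewrite mpE.
  rewrite prod_powR //; apply: ler_powR => //.
  rewrite sumrN; have := le_theta_max (a := a) (theta := theta) s.
  by move: th2; rewrite (bigD1 s) //=; lra.
have beta_le s : match_prob (color_weight (c := c) (n := n) (theta := theta))
    (color_match (a := a)) s <= x `^ (- theta_min theta a).
  by rewrite mpE; apply: ler_powR => //; rewrite lerN2 theta_min_le.
have q_ge0 k := color_weight_ge0 rc (Ordinal n0) k.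
have q_sum1 := sum_color_weight n theta c0.
apply: le_trans (poisson_approx r_gt1 q_ge0 q_sum1 A l0 l2 alpha_le beta_le) _.
rewrite prodE.
have rho1 : x^-1 <= rho.
  rewrite le_max; apply/orP; left; rewrite -(powR_inv1 (ltW x0)).
  by apply: ler_powR => //; have := theta_max_gt0 r_gt0 adm th0; lra.
have rho2 : x * x `^ (- 2 + theta_max theta a) <= rho.
  rewrite le_max; apply/orP; left; rewrite -{1}[x](powRr1 (ltW x0)) -powRD.
    by apply: ler_powR => //; lra.
  by rewrite (gt_eqF x0) implybT.
have rho3 : x `^ (- theta_min theta a) <= rho by rewrite le_max lexx orbT.
have rho0 : 0 <= rho by apply: le_trans rho1; rewrite invr_ge0 ltW.
pose M : R := #|APs r n|%:R.
have [Mle Mge] : 2 * m * M <= x ^+ 2 /\ x ^+ 2 <= 2 * m * M + 3 * m * x.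
  have r1 : (0 < r - 1)%N by lia.
  have := card_APs_bounds n r1; rewrite (_ : (r - 1).+1 = r); last by lia.
  by rewrite -!(ler_nat R) natrD natrX !natrM => /andP[].
have M0 : 0 <= M by rewrite ler0n.
have xx : 0 < x ^+ 2 by rewrite exprn_gt0.
have MQ : M * x ^- 2 <= 1.
  by rewrite ler_pdivrMr // mul1r; nra.
have MQ0 : 0 <= M * x ^- 2 by rewrite mulr_ge0 // invr_ge0 ltW.
have lM : `|lambda - M * x ^- 2| <= 2 * rho.
  have -> : lambda - M * x ^- 2 = (x ^+ 2 - 2 * m * M) / (2 * m * x ^+ 2).
    by rewrite /lambda -/m; field; rewrite !gt_eqF //; lra.
  have mx : 0 < 2 * m * x ^+ 2 by rewrite mulr_gt0 //; lra.
  rewrite ger0_norm; last by rewrite divr_ge0 //; [lra | exact: ltW].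
  (* The numerator is at most [3 * m * x], which is rounded up to [4 * m * x]. *)
  rewrite ler_pdivrMr //; apply: (@le_trans _ _ (2 * x^-1 * (2 * m * x ^+ 2))).
    have -> : 2 * x^-1 * (2 * m * x ^+ 2) = 4 * m * x.
      by field; rewrite gt_eqF.
    by nra.
  by rewrite ler_pM2r // ler_pM2l.
have r2 : 0 <= r%:R ^+ 2 :> R by rewrite exprn_ge0.
have r4 : 0 <= r%:R ^+ 4 :> R by rewrite exprn_ge0.
have -> : (4 + 8 * r%:R ^+ 2 + 4 * r%:R ^+ 4) * rho = 2 * (2 * rho) +
    4 * (1 * (r%:R ^+ 2 * (rho + rho) + r%:R ^+ 4 * rho)) by ring.
apply: lerD; first by rewrite ler_pM2l.
rewrite ler_pM2l //; apply: ler_pM => //.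
  rewrite addr_ge0 // mulr_ge0 // ?addr_ge0 ?powR_ge0 //.
  by rewrite invr_ge0 ltW.
rewrite natrM !natrX -mulrA; apply: lerD; apply: ler_wpM2l => //.
rewrite mulrDr lerD // (_ : _ * _ = x^-1) //.
by field; rewrite gt_eqF.
Qed.

(** * Convergence in distribution and the final statement *)

Lemma tv_distance_ge (R : realType) (d : measure_display)
    (T : measurableType d) (mu nu : probability T R) (A : set T) :
  measurable A -> (`|mu A - nu A| <= tv_distance mu nu)%E.
Proof. by move=> mA; apply: ereal_sup_ubound; exists A. Qed.

(** The distribution function at [x] is the measure of the set of integers at most [x], so its error
    is bounded by the total variation distance. *)
Lemma cvg_in_distribution_tv (R : realType)
    (d : nat -> measure_display) (Omega : forall n, measurableType (d n))
    (P : forall n, probability (Omega n) R) (X : forall n, {RV P n >-> nat})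
    (Q : probability nat R) (u : nat -> R) :
  (\forall n \near \oo, (tv_distance (distribution (P n) (X n)) Q <= (u n)%:E)%E) ->
  u n @[n --> \oo] --> (0 : R) ->
  cvg_in_distribution P (fun n => real_of_nat R \o X n) Q (real_of_nat R).
Proof.
move=> tvu u0 x _; pose A : set nat := real_of_nat R @^-1` `]-oo, x].
have QE : cdf (real_of_nat R : {RV Q >-> R}) x = Q A by [].
have XE n : cdf (real_of_nat R \o X n : {RV P n >-> R}) x =
  distribution (P n) (X n) A by [].
rewrite QE -(fineK (fin_num_measure Q A _)) //; apply: cvg_EFin.
  by apply: nearW => n; rewrite XE; exact: fin_num_measure.
apply/cvgrPdist_le => e e0.
have /cvgrPdist_le /(_ e e0) := u0; apply: filterS2 tvu => n tvn un /=.
rewrite XE -lee_fin.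
apply: (@le_trans _ _ (u n)%:E); last first.
  by move: un; rewrite sub0r normrN lee_fin; apply: le_trans; exact: ler_norm.
apply: le_trans tvn; rewrite distrC.
apply: le_trans (tv_distance_ge _ _ (A := A) _) => //.
rewrite -[X in (_ <= `|X - _|)%E]fineK ?fin_num_measure //.
by rewrite -[X in (_ <= `|_ - X|)%E]fineK ?fin_num_measure.
Qed.

Theorem theorem2p8 (R : realType) (r : nat) (hr : (3 <= r)%N) :
  exists2 C : R, 0 < C &
  forall (c : nat) (a : r.-tuple nat) (theta : nat -> R),
  (2 <= c)%N ->
  admissible c a ->
  (forall b, (1 <= b <= c.-1)%N -> 0 < theta b) ->
  \sum_(b <- colors a) (weight a b)%:R * theta b = 2 ->
  theta_max theta a < 1 ->
  let lambda : R := 1 / (2 * (r - 1)%:R) in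
  let rate (n : nat) : R :=
    Num.max (n%:R `^ (- 1 + theta_max theta a))
            (n%:R `^ (- theta_min theta a)) in
  [/\ 0 < theta_min theta a,
      rate n @[n --> \oo] --> (0 : R) &
      forall (d : nat -> measure_display)
        (Omega : forall n, measurableType (d n))
        (P : forall n, probability (Omega n) R)
        (phi : forall n, 'I_n -> {RV (P n) >-> nat}),
      (\forall n \near \oo, random_coloring c theta (phi n)) ->
      (\forall n \near \oo,
         (tv_distance (distribution (P n) (colorful_count a (phi n)))
            (Pois lambda) <= (C * rate n)%:E)%E) /\
      cvg_in_distribution
        P (fun n => real_of_nat R \o colorful_count a (phi n))
        (Pois lambda) (real_of_nat R)].

Proof.
exists (4 + 8 * r%:R ^+ 2 + 4 * r%:R ^+ 4).
  by rewrite !ltr_wpDr ?mulr_ge0 ?exprn_ge0.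
move=> c a theta c2 adm th0 th2 thmax lambda rate.
have r0 : (0 < r)%N by exact: leq_trans hr.
have c0 : (0 < c)%N by exact: leq_trans c2.
have rate0 : rate n @[n --> \oo] --> (0 : R).
  have c1 := @cvg_natr_powRN R (1 - theta_max theta a).
  have c2' := @cvg_natr_powRN R _ (theta_min_gt0 r0 adm th0).
  rewrite subr_gt0 opprB addrC in c1.
  have cD := cvgD (c1 thmax) c2'; rewrite addr0 in cD.
  (* The maximum of two nonnegative powers lies between [0] and their sum. *)
  apply: (squeeze_cvgr _ (cvg_cst (0 : R)) (cD _)).
  apply: nearW => n; rewrite le_max powR_ge0 /= ge_max lerDl lerDr.
  by rewrite !powR_ge0.
split=> //; first exact: theta_min_gt0 adm th0.
move=> d Omega P phi rc.
have tv : \forall n \near \oo,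
    (tv_distance (distribution (P n) (colorful_count a (phi n)))
       (Pois lambda) <= ((4 + 8 * r%:R ^+ 2 + 4 * r%:R ^+ 4) * rate n)%:E)%E.
  apply: filterS2 rc (nbhs_infty_gt 0) => n rcn n0.
  exact: tv_colorful_count_le adm th0 th2 rcn.
split=> //; apply: cvg_in_distribution_tv tv _.
rewrite -[X in _ --> X](mulr0 (4 + 8 * r%:R ^+ 2 + 4 * r%:R ^+ 4)).
by apply: cvgM => //; exact: cvg_cst.
Qed.
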